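(* Let $B=\big(\binom{n}{k}\big)_{n,k\ge 0}$ be the binomial matrix. Then: (a) $\check{C}^{(2)} = E^{(2)} B$. (b) $\check{S}^{(2)} = \check{E}^{(2)} B$.
   Context: All matrices are infinite lower-triangular with rows and columns indexed by $n,k\ge 0$. For $n,k\ge0$, $\left[{n\atop k}\right]^{(2)}$ is the number of permutations of $[n+k]$ with exactly $k$ cycles, all of size $\ge 2$, and $\left\{{n\atop k}\right\}^{(2)}$ is the number of set partitions of $[n+k]$ into exactly $k$ blocks, all of size $\ge 2$. The row-reversed matrices are $\check{C}^{(2)}=\big(\left[{n\atop n-k}\right]^{(2)}\big)_{n,k\ge0}$ and $\check{S}^{(2)}=\big(\left\{{n\atop n-k}\right\}^{(2)}\big)_{n,k\ge0}$, with entries defined to be $0$ when $k>n$. A Stirling permutation of size $n$ is a permutation (word) of the multiset $\{1,1,2,2,\ldots,n,n\}$ such that for every $i\in[n]$ all entries between the two occurrences of $i$ exceed $i$. An ascent of a word $w_1\cdots w_N$ is a pair $(w_i,w_{i+1})$ with $1\le i\le N-1$ and $w_i<w_{i+1}$. The second-order Eulerian number $\left\langle\!\left\langle{n\atop k}\right\rangle\!\right\rangle$ is the number of Stirling permutations of size $n$ with exactly $k$ ascents (so it is $\delta_{k0}$ for $n=0$, and $0$ for $k<0$). Then $E^{(2)}=\big(\left\langle\!\left\langle{n\atop k}\right\rangle\!\right\rangle\big)_{n,k\ge0}$, and $\check{E}^{(2)}$ is the matrix whose $(n,k)$ entry is $\left\langle\!\left\langle{n\atop n-k-1}\right\rangle\!\right\rangle$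 for $n\ge 1$, and whose row $n=0$ is $(1,0,0,\ldots)$. *)

(* Defs.v *)
From mathcomp Require Import all_boot perm.

Set Implicit Arguments.
Unset Strict Implicit.
Unset Printing Implicit Defensive.

Local Open Scope nat_scope.

Definition natmx := nat -> nat -> nat.

Definition lower_triangular (A : natmx) := forall n k, n < k -> A n k = 0.

(* The product of infinite matrices; the sum over all j stops at j = n because
   A is meant to be lower-triangular (see the lower_triangular lemmas below). *)
Definition ltmul (A B : natmx) : natmx :=
  fun n k => \sum_(j < n.+1) A n j * B j k.

Definition binmx : natmx := fun n k => 'C(n, k).

(* porbits includes the fixed points of s as singletons. *)
Definition stirling1_assoc (n k : nat) : nat :=
  #|[set s : {perm 'I_(n + k)} |
      (#|porbits s| == k) && [forall X in porbits s, 2 <= #|X|]]|.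

Definition stirling2_assoc (n k : nat) : nat :=
  #|[set P : {set {set 'I_(n + k)}} |
      [&& partition P [set: 'I_(n + k)], #|P| == k
        & [forall X in P, 2 <= #|X|]]]|.

(* The letters 1, ..., n are encoded as the elements 0, ..., n - 1 of 'I_n. *)
Definition is_stirling_perm (n : nat) (w : n.*2.-tuple 'I_n) : bool :=
  [forall i : 'I_n, count_mem i w == 2] &&
  [forall a : 'I_(n.*2), forall b : 'I_(n.*2), forall c : 'I_(n.*2),
    [&& a < b, b < c & tnth w a == tnth w c] ==> (tnth w a < tnth w b)].

Definition ascents (n N : nat) (w : N.-tuple 'I_n) : nat :=
  #|[set p : 'I_N * 'I_N |
      (p.2 == p.1.+1 :> nat) && (tnth w p.1 < tnth w p.2)]|.

Definition eulerian2 (n k : nat) : nat :=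
  #|[set w : n.*2.-tuple 'I_n | is_stirling_perm w && (ascents w == k)]|.

Definition stirling1_rev : natmx :=
  fun n k => if k <= n then stirling1_assoc n (n - k) else 0.

Definition stirling2_rev : natmx :=
  fun n k => if k <= n then stirling2_assoc n (n - k) else 0.

Definition eulerian2_mx : natmx := eulerian2.

(* The guard k < n implements the convention that eulerian2 vanishes at the
   negative integers n - k - 1, which truncated subtraction would send to 0. *)
Definition eulerian2_rev : natmx :=
  fun n k => if n == 0 then (k == 0) : nat
             else if k < n then eulerian2 n (n - k - 1) else 0.

Lemma binmx_lt : lower_triangular binmx.
Proof. by move=> n k; apply: bin_small. Qed.

Lemma stirling1_rev_lt : lower_triangular stirling1_rev.
Proof. by move=> n k nk; rewrite /stirling1_rev leqNgt nk. Qed.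

Lemma stirling2_rev_lt : lower_triangular stirling2_rev.
Proof. by move=> n k nk; rewrite /stirling2_rev leqNgt nk. Qed.

Lemma eulerian2_rev_lt : lower_triangular eulerian2_rev.
Proof.
move=> n k nk; rewrite /eulerian2_rev ltnNge (ltnW nk) /=.
by case: eqP => // n0; case: k nk => //; rewrite n0.
Qed.

Lemma ascents_le n (w : n.*2.-tuple 'I_n) : is_stirling_perm w -> ascents w <= n.
Proof.
case/andP=> _ /forallP sw.
have top (p q : 'I_(n.*2) * 'I_(n.*2)) :
    (q.2 == q.1.+1 :> nat) && (tnth w q.1 < tnth w q.2) ->
    tnth w p.2 = tnth w q.2 -> ~~ (p.2 < q.2).
  case/andP=> /eqP q21 asc eqv; apply/negP; rewrite q21 ltnS leq_eqVlt.
  case/orP=> [/eqP/ord_inj pq | pq]; first by rewrite -eqv pq ltnn in asc.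
  have /forallP/(_ q.1)/forallP/(_ q.2)/implyP := sw p.2.
  rewrite pq q21 ltnSn eqv eqxx /= => /(_ isT) /(ltn_trans asc).
  by rewrite ltnn.
rewrite /ascents -[leqRHS]card_ord -(card_in_imset (f := fun p => tnth w p.2)).
  exact: max_card.
move=> p q; rewrite !inE => hp hq eqv.
have e2 : p.2 = q.2.
  apply/ord_inj/eqP; rewrite eqn_leq [p.2 <= _]leqNgt [q.2 <= _]leqNgt.
  by rewrite (top p q hq eqv) (top q p hp (esym eqv)).
have /andP[/eqP p21 _] := hp; have /andP[/eqP q21 _] := hq.
have e1 : p.1 = q.1 by apply/ord_inj/succn_inj; rewrite -p21 -q21 e2.
by case: p q e1 e2 {hp hq eqv p21 q21} => [? ?] [? ?] /= -> ->.
Qed.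

Lemma eulerian2_mx_lt : lower_triangular eulerian2_mx.
Proof.
move=> n k nk; apply/eqP; rewrite cards_eq0; apply/eqP/setP=> w; rewrite !inE.
apply/negbTE/negP=> /andP[/ascents_le le /eqP e].
by move: nk; rewrite -e ltnNge le.
Qed.

(* Main.v *)
(* All three families obey a recurrence obtained by removing an element.
   Inserting nn into one of the 2n+1 gaps of a Stirling permutation of
   {1,1,...,n,n} with a ascents keeps a for the first gap and for the a gaps
   inside an ascent, and raises it by one for the other 2n-a gaps. Hence the sum
   over Stirling permutations of size n+1 of g(asc) is the sum over those of
   size n of (a+1) g(a) + (2n-a) g(a+1). With c and s the two row-reversed
   matrices, deleting an element from a permutation or from a partition gives
     c(n+1,k) = (2n+1-k) (c(n,k) + c(n,k-1)),
     s(n+1,k) = (2n+1-k) s(n,k) + (n+1-k) s(n,k-1).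
   By induction on n, c(n,k) is the sum of binom(asc,k) over the Stirling
   permutations of size n, and s(n,k) that of binom(n-1-asc,k): in both cases
   the induction step is a binomial identity valid word by word. *)

Require Import Defs.
From mathcomp Require Import all_boot fingroup perm.
From mathcomp Require Import zify.

Set Implicit Arguments.
Unset Strict Implicit.
Unset Printing Implicit Defensive.

(** * Stirling permutations as words *)

Definition insert2 (n i : nat) (w : seq nat) : seq nat :=
  take i w ++ [:: n, n & drop i w].

(** The two copies of the largest letter are adjacent in a Stirling permutation, so each one arises
    from exactly one insertion and is listed once. *)
Fixpoint stirling_words (n : nat) : seq (seq nat) :=
  if n is m.+1 then
    [seq insert2 m i w | w <- stirling_words m, i <- iota 0 (size w).+1]
  else [:: [::]].

(* The ascents of [x :: w]; for [x] at least as large as every letter of [w]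
   these are the ascents of [w] itself. *)
Fixpoint ascents_from (x : nat) (w : seq nat) : nat :=
  if w is y :: v then (x < y) + ascents_from y v else 0.

Lemma ascents_from_size x w : ascents_from x w <= size w.
Proof. by elim: w x => //= y w IH x; have := IH y; case: (x < y) => /=; lia. Qed.

Lemma eq_ascents_from x y w :
  all (geq x) w -> all (geq y) w -> ascents_from x w = ascents_from y w.
Proof. by case: w => //= z w /andP[xz _] /andP[yz _]; congr (nat_of_bool _ + _); lia. Qed.

(** Every gap follows a letter below [n]: filling a gap inside an ascent keeps the count, filling
    any other gap, the last included, adds one. The induction splits off the front gap, and [g]
    absorbs the comparison of [x] with the first letter. *)
Lemma sum_insert2_interior (n x : nat) (w : seq nat) (g : nat -> nat) :
  x < n -> all (ltn^~ n) w ->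
  \sum_(i <- iota 0 (size w).+1) g (ascents_from x (insert2 n i w)) =
  ascents_from x w * g (ascents_from x w)
  + (size w + 1 - ascents_from x w) * g (ascents_from x w).+1.
Proof.
elim: w x g => [|y w IH] x g xn.
  by rewrite big_seq1 /= xn ltnn mul1n.
case/andP=> yn wn.
rewrite -[iota 0 _]/(0 :: iota (1 + 0) (size w).+1) big_cons iotaDl big_map.
rewrite /= xn ltnn ltnNge (ltnW yn) /=.
rewrite (IH _ (fun a => g ((x < y) + a))) //.
have := ascents_from_size y w; set a := ascents_from y w => aw.
case: (x < y); rewrite /= ?add0n ?add1n.
  have -> : (size w).+1 + 1 - a.+1 = size w + 1 - a by lia.
  by rewrite mulSn addnA.
have -> : (size w).+1 + 1 - a = (size w + 1 - a).+1 by lia.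
by rewrite mulSn addnCA.
Qed.

(** With [n] itself in front, filling the front gap creates no ascent, so one more insertion keeps
    the count. *)
Lemma sum_insert2 (n : nat) (w : seq nat) (g : nat -> nat) :
  all (ltn^~ n) w ->
  \sum_(i <- iota 0 (size w).+1) g (ascents_from n (insert2 n i w)) =
  (ascents_from n w).+1 * g (ascents_from n w)
  + (size w - ascents_from n w) * g (ascents_from n w).+1.
Proof.
case: w => [|y w]; first by rewrite big_seq1 /= ltnn [RHS]addn0 mul1n.
case/andP=> yn wn.
rewrite -[iota 0 _]/(0 :: iota (1 + 0) (size w).+1) big_cons iotaDl big_map.
rewrite /= ltnn ltnNge (ltnW yn) /= !add0n.
rewrite (sum_insert2_interior _ yn wn).
by rewrite addn1 mulSn addnA.
Qed.

(** Stating the nesting condition through subsequences avoids positions and makes it pass to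
    subwords at once. *)
Definition stirling_word (n : nat) (w : seq nat) : Prop :=
  [/\ all (ltn^~ n) w, forall i, i < n -> count_mem i w = 2
    & forall i j, subseq [:: i; j; i] w -> i < j].

Lemma subseq_cons_cat (T : eqType) (x : T) s p q :
  x \notin p -> subseq (x :: s) (p ++ x :: q) = subseq s q.
Proof.
elim: p => [|y p IH] /=; first by rewrite eqxx.
by rewrite inE negb_or => /andP[/negbTE-> /IH].
Qed.

Lemma insert2_stirling_word n i w :
  stirling_word n w -> stirling_word n.+1 (insert2 n i w).
Proof.
case=> [wn cw sw].
have nw : n \notin w by apply/negP => /(allP wn); rewrite /= ltnn.
have : all (ltn^~ n) (take i w ++ drop i w) by rewrite cat_take_drop.
have : forall j, j < n -> count_mem j (take i w ++ drop i w) = 2 by rewrite cat_take_drop.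
have : n \notin take i w ++ drop i w by rewrite cat_take_drop.
have fw : take i w ++ drop i w = w by rewrite cat_take_drop.
rewrite /insert2; move: (take i w) (drop i w) fw => p s fw.
rewrite mem_cat negb_or => /andP[np ns] cps; rewrite all_cat => /andP[pn sn].
have lt_ltS u : all (ltn^~ n) u -> all (ltn^~ n.+1) u.
  by apply: sub_all => x /= /ltnW.
split.
- by rewrite all_cat /= ltnSn !lt_ltS.
- move=> j; rewrite ltnS leq_eqVlt => /orP[/eqP->|jn].
    by rewrite count_cat /= eqxx !(count_memPn _).
  by rewrite count_cat /= eqn_leq leqNgt jn -(cps _ jn) count_cat.
- move=> a b sub.
  have [an|an] := ltnP a n; last first.
    have ea : a = n.
      have : a \in p ++ [:: n, n & s] by apply: (mem_subseq sub); rewrite inE eqxx.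
      rewrite mem_cat !inE => /or4P[/(allP pn)|/eqP|/eqP|/(allP sn)] //=; lia.
    (* Matching the leading [n] greedily with the first inserted copy would leave an [n] to be found
       in [s]. *)
    move: sub; rewrite ea subseq_cons_cat //=.
    case: eqP => [_ /mem_subseq/(_ n)|_ /mem_subseq/(_ n)].
      by rewrite inE eqxx (negbTE ns) => /(_ isT).
    by rewrite !inE eqxx orbT (negbTE ns) => /(_ isT).
  have [bn|bn] := ltnP b n; last exact: leq_trans an bn.
  apply: sw.
  (* A pattern made of letters below [n] survives the erasure of [n], hence already occurs in
     [w]. *)
  have : subseq [:: a; b; a] (filter (ltn^~ n) (p ++ [:: n, n & s])).
    by rewrite subseq_filter sub /= an bn.
  by rewrite filter_cat /= ltnn !(all_filterP _) // fw.
Qed.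

Lemma split_first (T : eqType) (x : T) (w : seq T) :
  x \in w -> exists p, exists2 q, x \notin p & w = p ++ x :: q.
Proof.
elim: w => // y w IH; rewrite inE eq_sym.
case: eqP => [<- _|/eqP yx /IH[p [q xp ->]]]; first by exists [::], w.
by exists (y :: p), q; rewrite // inE negb_or eq_sym yx.
Qed.

(** A letter between the two copies of the maximum [n] would have to exceed [n]; the copies are
    therefore adjacent and can be deleted together. *)
Lemma stirling_word_insert2 n w : stirling_word n.+1 w ->
  exists2 v, stirling_word n v & exists2 i, i <= size v & w = insert2 n i v.
Proof.
case=> [wn cw sw].
have nw : n \in w by rewrite -has_pred1 has_count cw.
have [p [q np wE]] := split_first nw; rewrite {w nw}wE in wn cw sw *.
have nq : n \in q.
  rewrite -has_pred1 has_count; have := cw n (ltnSn n).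
  by rewrite count_cat (count_memPn np) /= eqxx add0n add1n => -[->].
have [r [s nr qE]] := split_first nq; rewrite {q nq}qE in wn cw sw *.
have ns : n \notin s.
  have := cw n (ltnSn n).
  rewrite count_cat /= count_cat /= eqxx (count_memPn np) (count_memPn nr).
  by rewrite !add0n !add1n => -[/count_memPn].
case: r nr => [|j r] nr in wn cw sw *; last first.
  have jn : j < n.+1 by apply: (allP wn _); rewrite !(mem_cat, inE) eqxx !orbT.
  have : n < j.
    apply: sw; rewrite subseq_cons_cat //= eqxx -cat1s.
    by apply: subseq_trans (suffix_subseq _ _); rewrite /= eqxx sub0seq.
  by move: jn; lia.
have sps : subseq (p ++ s) (p ++ [:: n, n & s]).
  by apply: cat_subseq => //; apply: (suffix_subseq [:: n; n]).
exists (p ++ s).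
  split.
  - apply/allP => x xps; have := (allP wn) x (mem_subseq sps xps).
    rewrite /= ltnS leq_eqVlt => /orP[/eqP xn|//].
    by rewrite xn mem_cat (negbTE np) (negbTE ns) in xps.
  - move=> i lin; rewrite -(cw i (ltnW lin)) !count_cat /=.
    by rewrite gtn_eqF.
  - by move=> i j ss; apply: sw; apply: subseq_trans ss sps.
exists (size p); first by rewrite size_cat leq_addr.
by rewrite /insert2 take_size_cat // drop_size_cat.
Qed.

Lemma stirling_wordsSP n w :
  reflect (exists v, exists2 i, v \in stirling_words n & i <= size v /\ w = insert2 n i v)
          (w \in stirling_words n.+1).
Proof.
rewrite -[stirling_words n.+1]/(allpairs_dep _ _ _).
apply: (iffP allpairsPdep) => [[v [i [vL iv ->]]]|[v [i vL [iv ->]]]].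
  by exists v, i; rewrite // mem_iota in iv *.
by exists v, i; rewrite mem_iota.
Qed.

Lemma stirling_wordsP n w : reflect (stirling_word n w) (w \in stirling_words n).
Proof.
elim: n w => [|n IH] w.
  rewrite /= inE; apply: (iffP eqP) => [->|[]]; first by split.
  by case: w.
apply: (iffP (stirling_wordsSP _ _)).
  by move=> [v [i /IH sv [_ ->]]]; apply: insert2_stirling_word.
case/stirling_word_insert2=> v sv [i iv ->].
by exists v, i; first apply/IH.
Qed.

Lemma size_stirling_words n w : w \in stirling_words n -> size w = n.*2.
Proof.
elim: n w => [|n IH] w; first by rewrite inE => /eqP->.
move=> /stirling_wordsSP[v [i /IH sv [_ ->]]].
by rewrite size_cat /= !addnS -size_cat cat_take_drop sv.
Qed.

(** The position is recovered as the index of the first [n], the word by erasing [n]. *)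
Lemma insert2_inj n i j v w :
  n \notin v -> n \notin w -> i <= size v -> j <= size w ->
  insert2 n i v = insert2 n j w -> i = j /\ v = w.
Proof.
have idx k u : n \notin u -> k <= size u -> index n (insert2 n k u) = k.
  move=> nu ku; rewrite index_cat ifN; last by apply: contra nu; apply: mem_take.
  by rewrite /= eqxx addn0 size_takel.
have fil k u : n \notin u -> filter (predC1 n) (insert2 n k u) = u.
  move=> nu; rewrite filter_cat /= eqxx /= -filter_cat cat_take_drop.
  by apply/all_filterP/allP => x xu /=; apply: contraNneq nu => <-.
move=> nv nw iv jw e; split; first by rewrite -(idx i v) // e idx.
by rewrite -(fil i v) // e fil.
Qed.

Lemma uniq_stirling_words n : uniq (stirling_words n).
Proof.
elim: n => // n IH; apply: allpairs_uniq_dep => // [w _|]; first exact: iota_uniq.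
have notin v : v \in stirling_words n -> n \notin v.
  by move=> /stirling_wordsP[vn _ _]; apply/negP => /(allP vn); rewrite /= ltnn.
move=> _ _ /allpairsPdep[v [i [vL iv ->]]] /allpairsPdep[w [j [wL jw ->]]] /=.
rewrite !mem_iota /= !add0n !ltnS in iv jw.
by case/insert2_inj; rewrite ?notin // => -> ->.
Qed.

Definition sum_stirling_words (n : nat) (g : nat -> nat) : nat :=
  \sum_(w <- stirling_words n) g (ascents_from n w).

Lemma sum_stirling_words0 g : sum_stirling_words 0 g = g 0.
Proof. by rewrite /sum_stirling_words /= big_seq1. Qed.

Lemma sum_stirling_wordsS n g :
  sum_stirling_words n.+1 g =
  sum_stirling_words n (fun a => a.+1 * g a + (n.*2 - a) * g a.+1).
Proof.
rewrite /sum_stirling_words big_allpairs_dep big_seq_cond [RHS]big_seq_cond.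
apply: eq_bigr => w /andP[wL _]; have [wn _ _] := stirling_wordsP _ _ wL.
rewrite -(size_stirling_words wL) -(sum_insert2 _ wn).
apply: eq_bigr => i _; congr g.
(* The sentinel is [n.+1] on one side and [n] on the other; both dominate every letter of the new
   word, so the ascents agree. *)
have wi : all (leq^~ n) (insert2 n i w).
  have : all (leq^~ n) w by apply: sub_all wn => x; apply: ltnW.
  by rewrite -{1}(cat_take_drop i w) !all_cat /= !leqnn.
by apply: eq_ascents_from => //; apply: sub_all wi => x /= /leqW.
Qed.

(** * Translation between tuples and words *)

Lemma subseq3P (T : eqType) (x0 x y z : T) (s : seq T) :
  reflect (exists a b c, [/\ a < b, b < c, c < size s
                           & [:: x; y; z] = [seq nth x0 s i | i <- [:: a; b; c]]])
          (subseq [:: x; y; z] s).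
Proof.
apply: (iffP idP) => [sub|[a [b [c [ab bc cs ->]]]]].
  have cons_split u (t v : seq T) : subseq (u :: t) v ->
      exists p, exists2 q, v = p ++ u :: q & subseq t q.
    move=> tv; have uv : u \in v by apply: (mem_subseq tv); rewrite inE eqxx.
    have [p [q up vE]] := split_first uv; exists p, q => //.
    by move: tv; rewrite vE subseq_cons_cat.
  have [p [q -> /cons_split[p' [q' -> /cons_split[p2 [q2 -> _]]]]]] := cons_split _ _ _ sub.
  exists (size p), (size p + (size p').+1), (size p + (size p' + (size p2).+1).+1).
  have nthD k (u v : seq T) : nth x0 (u ++ v) (size u + k) = nth x0 v k.
    by rewrite nth_cat ltnNge leq_addr addKn.
  have nth0 (u : seq T) t v : nth x0 (u ++ t :: v) (size u) = t.
    by rewrite nth_cat ltnn subnn.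
  split; first by lia.
  - by lia.
  - by do 3!rewrite ?size_cat /=; lia.
  - by rewrite /= !(nthD, nth0) /= !(nthD, nth0) /= ?nth0.
rewrite -[X in subseq _ X](mkseq_nth x0); apply: map_subseq.
(* The strictly increasing positions [a, b, c] form a subsequence of all positions, and mapping by
   [nth] preserves this. *)
suff -> : [:: a; b; c] = filter [in [:: a; b; c]] (iota 0 (size s)).
  exact: filter_subseq.
apply: (irr_sorted_eq ltn_trans ltnn); first by rewrite /= ab bc.
  by rewrite sorted_filter ?iota_ltn_sorted //; apply: ltn_trans.
move=> i; rewrite mem_filter mem_iota /= !inE; case: eqP => [->|_] /=; first by lia.
by case: eqP => [->|_] /=; [lia | case: eqP => [->|_] //=; lia].
Qed.

Lemma is_stirling_permP n (w : n.*2.-tuple 'I_n) :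
  reflect (stirling_word n (map val w)) (is_stirling_perm w).
Proof.
have cnt i : count_mem (val i) (map val w) = count_mem i w.
  by rewrite count_map; apply: eq_count => j /=; rewrite val_eqE.
have sz : size (map val w) = n.*2 by rewrite size_map size_tuple.
have nthE (a : 'I_(n.*2)) : nth n (map val w) a = tnth w a.
  by rewrite (nth_map (tnth w a)) ?size_tuple // -tnth_nth.
apply: (iffP andP) => [[/forallP cw /forallP sw]|[wn cw sw]].
  split.
  - by apply/allP => _ /mapP[i _ ->] /=.
  - by move=> i lin; rewrite (cnt (Ordinal lin)); apply/eqP.
  - move=> i j /(subseq3P n)[a [b [c [ab bc]]]]; rewrite sz => cs [-> -> /= ac].
    have bs := ltn_trans bc cs; have as_ := ltn_trans ab bs.
    move: ac; rewrite (nthE (Ordinal as_)) (nthE (Ordinal bs)) (nthE (Ordinal cs)).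
    move=> /val_inj ac.
    have /forallP/(_ (Ordinal bs))/forallP/(_ (Ordinal cs))/implyP := sw (Ordinal as_).
    by apply; rewrite /= ab bc ac eqxx.
split; first by apply/forallP=> i; rewrite -cnt cw ?ltn_ord.
apply/forallP => a; apply/forallP=> b; apply/forallP=> c; apply/implyP.
case/and3P=> ab bc /eqP ac; apply: sw; apply/(subseq3P n).
by exists a, b, c; rewrite sz /= !nthE ac.
Qed.

Lemma ascents_from_sum x (w : seq nat) :
  ascents_from x w = \sum_(i < size w) (nth x (x :: w) i < nth x w i).
Proof.
(* The default [x] of [nth] stays fixed while the head [z] varies along the induction. *)
have gen z : ascents_from z w = \sum_(i < size w) (nth x (z :: w) i < nth x w i).
  by elim: w z => [|y w IH] z /=; rewrite ?big_ord0 // big_ord_recl IH.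
exact: gen.
Qed.

Lemma ascentsE n N (w : N.-tuple 'I_n) : ascents w = ascents_from n (map val w).
Proof.
have nthE (a : 'I_N) : nth n (map val w) a = tnth w a.
  by rewrite (nth_map (tnth w a)) ?size_tuple // -tnth_nth.
rewrite ascents_from_sum size_map size_tuple.
rewrite /ascents -sum1dep_card big_mkcond /=.
pose F (a b : 'I_N) := ((b == a.+1 :> nat) && (tnth w a < tnth w b) : nat).
transitivity (\sum_b \sum_a F a b).
  by rewrite exchange_big (pair_bigA _ F); apply: eq_bigr => p _; rewrite /F; case: ifP.
apply: eq_bigr => -[[|b] bN] _.
  (* Position [0] has no predecessor, and the sentinel [n] in front of it makes no ascent. *)
  by rewrite big1 //= (nthE (Ordinal bN)) ltnNge ltnW.
pose a := Ordinal (ltnW bN).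
rewrite (bigD1 a) //= big1 ?addn0 => [|i ia].
  by rewrite /F /= eqxx (nthE (Ordinal bN)) (nthE a).
rewrite /F /= eqSS; case: eqP => // bi; case/eqP: ia.
by apply: val_inj; rewrite /= bi.
Qed.

Lemma sum_stirling_wordsE n g :
  sum_stirling_words n g = \sum_(w : n.*2.-tuple 'I_n | is_stirling_perm w) g (ascents w).
Proof.
pose f (w : n.*2.-tuple 'I_n) := map val w : seq nat.
rewrite /sum_stirling_words (perm_big [seq f w | w <- enum [pred w | is_stirling_perm w]]).
  by rewrite big_map big_enum; apply: eq_bigr => w _; rewrite ascentsE.
have f_inj : injective f by move=> v w /(inj_map val_inj)/val_inj.
apply: uniq_perm; rewrite ?uniq_stirling_words ?(map_inj_uniq f_inj) ?enum_uniq //.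
move=> s; apply/idP/mapP => [sL|[w]]; last first.
  by rewrite mem_enum => /is_stirling_permP sw ->; apply/stirling_wordsP.
have sw := stirling_wordsP _ _ sL; have ss := size_stirling_words sL.
case: sw => sn _ _.
have sE : map val (pmap (insub : nat -> option 'I_n) s) = s.
  rewrite pmap_filter; last exact: insubK.
  by apply/all_filterP; apply: sub_all sn => i /= lin; rewrite insubT.
have szv : size (pmap (insub : nat -> option 'I_n) s) == n.*2.
  by rewrite -(size_map val) sE ss.
exists (Tuple szv); last by rewrite /f /= sE.
by rewrite mem_enum inE; apply/is_stirling_permP; rewrite /= sE; apply/stirling_wordsP.
Qed.

(** Words are grouped by their number of ascents, which [ascents_le] keeps in the range where
    [inord] is faithful. A matrix product with row [n] of the Eulerian matrix thus becomes a sum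
    over words. *)
Lemma sum_eulerian2 n (g : nat -> nat) :
  \sum_(j < n.+1) eulerian2 n j * g j = sum_stirling_words n g.
Proof.
rewrite sum_stirling_wordsE.
rewrite (partition_big (fun w => inord (ascents w) : 'I_n.+1) xpredT) //=.
apply: eq_bigr => j _; rewrite /eulerian2 -sum1dep_card big_distrl /=.
apply: eq_big => [w|w /andP[_ /eqP->]]; last by rewrite mul1n.
case: (boolP (is_stirling_perm w)) => // /ascents_le le /=.
by rewrite -val_eqE /= inordK.
Qed.

(** * Permutations without fixed points *)

Section Derangements.

Variable T : finType.
Implicit Types (A : {set T}) (s t : {perm T}).

Definition moved s : {set T} := [set x | s x != x].

(** The cycle count [c] includes the fixed points outside [A], so that [T] need not change when a
    point is removed. *)
Definition perms_moving A c : {set {perm T}} :=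
  [set s | (moved s == A) && (#|porbits s| == c)].

Lemma porbit_fixed s x : s x = x -> porbit s x = [set x].
Proof.
move=> sx; apply/setP=> y; rewrite inE; apply/porbitP/eqP => [[i ->]|->].
  by rewrite permX iter_fix.
by exists 0; rewrite expg0 perm1.
Qed.

Lemma perms_moving0 c : #|perms_moving set0 c| = (c == #|T|).
Proof.
have p1 : #|porbits (1%g : {perm T})| = #|T|.
  by rewrite card_imset // => x y; rewrite !porbit_fixed ?perm1 // => /set1_inj.
have -> : perms_moving set0 c = if c == #|T| then [set 1%g] else set0; last first.
  by case: eqP; rewrite ?cards1 ?cards0.
apply/setP=> s; rewrite inE.
have -> : (moved s == set0) = (s == 1%g).
  apply/eqP/eqP => [s0|->]; last by apply/setP=> x; rewrite !inE perm1 eqxx.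
  apply/permP=> x; rewrite perm1; apply/eqP/negbNE/negP=> sx.
  have : x \in moved s by rewrite inE.
  by rewrite s0 inE.
case: (eqVneq c #|T|) => cT.
  by rewrite inE cT; case: eqP => // ->; rewrite p1 eqxx.
rewrite inE; case: eqP => // ->; rewrite p1 eq_sym; exact: negbTE.
Qed.

(* If [s y = x], then [t = tperm x y * s] is [s] with [x] cut out of its cycle;
   the two cases are whether that leaves [y] fixed, i.e. whether [s x = y]. *)
Lemma perms_moving_split A x y c : x \in A -> y \in A :\ x ->
  [set s in perms_moving A c | s y == x] =
  [set (tperm x y * t)%g | t in perms_moving (A :\ x) c.+1 :|: perms_moving (A :\ x :\ y) c.+1].
Proof.
move=> xA /setD1P[yx yA].
have moved_split t : t x = x -> (moved (tperm x y * t)%g == A) =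
    (moved t == A :\ x) || (moved t == A :\ x :\ y).
  move=> tx.
  have ty : t y != x by rewrite -[X in _ != X]tx (inj_eq perm_inj).
  (* Inserting the fixed point [x] of [t] after [y] makes both [x] and [y] moved and changes no
     other status. *)
  have mE z : (z \in moved (tperm x y * t)%g) = [|| z == x, z == y | z \in moved t].
    rewrite !inE permM; case: tpermP => [->|->|]; rewrite ?eqxx ?orbT //=.
    - by rewrite tx eq_sym yx.
    - by move=> /eqP/negbTE-> /eqP/negbTE->.
  have mx : x \notin moved t by rewrite inE tx eqxx.
  apply/eqP/orP => [mA|mA].
    have [ym|ym] := boolP (y \in moved t); [left|right]; apply/eqP/setP=> z;
      move/setP/(_ z): mA; rewrite mE !in_setD1.
      by case: eqP => [->|_] /=; [rewrite (negbTE mx) | case: eqP => [->|_] //=; rewrite ym yA].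
    case: eqP => [->|_] /=; first by rewrite (negbTE mx) andbF.
    by case: eqP => [->|_] /=; first by rewrite (negbTE ym).
  apply/setP=> z; rewrite mE; case: eqP => [->|zx] //=; case: eqP => [->|zy] //=.
  by case: mA => /eqP->; rewrite !inE; case: eqP => //; case: eqP.
(* The transposition merges the singleton cycle of [x] with the cycle of [y], which loses one
   cycle. *)
have porb t : t x = x -> #|porbits (tperm x y * t)| = c <-> #|porbits t| = c.+1.
  move=> tx; have := porbits_mul_tperm t x y; rewrite eq_sym in yx.
  rewrite porbit_sym porbit_fixed // inE eq_sym yx /=; lia.
apply/setP=> s; apply/idP/imsetP => [|[t tP ->]].
  rewrite !inE => /andP[/andP[ms ps] /eqP sy].
  exists (tperm x y * s)%g; last by rewrite tpermKg.
  have tx : (tperm x y * s)%g x = x by rewrite permM tpermL.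
  have sE : s = (tperm x y * (tperm x y * s))%g by rewrite tpermKg.
  rewrite !inE -andb_orl -moved_split // -sE ms /=; apply/eqP/porb => //.
  by rewrite -sE; apply/eqP.
have tx : t x = x.
  apply/eqP/negbNE/negP=> tx; have : x \in moved t by rewrite inE.
  by case/setUP: tP; rewrite inE => /andP[/eqP-> _]; rewrite !inE eqxx ?andbF.
rewrite !inE permM tpermR tx eqxx andbT moved_split //.
move: tP; rewrite !inE -andb_orl => /andP[-> /= /eqP tc]; apply/eqP/porb => //.
Qed.

(** The permutations are classified by the preimage [y] of [x], and [x] is then cut out of its
    cycle. *)
Lemma card_perms_movingS A x c : x \in A ->
  #|perms_moving A c| =
  \sum_(y in A :\ x) (#|perms_moving (A :\ x) c.+1| + #|perms_moving (A :\ x :\ y) c.+1|).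
Proof.
move=> xA; rewrite -sum1_card.
rewrite (partition_big (fun s : {perm T} => (s^-1)%g x) [in A :\ x]) /=; last first.
  move=> s; rewrite inE => /andP[/eqP mA _].
  have sx : s x != x by rewrite -mA inE in xA.
  have sVx : (s^-1)%g x != x by apply: contra sx => /eqP e; rewrite -{1}e permKV.
  by rewrite -mA !inE permKV sVx eq_sym.
apply: eq_bigr => y yA.
rewrite sum1dep_card.
have -> : [set s in perms_moving A c | (s^-1)%g x == y] = [set s in perms_moving A c | s y == x].
  by apply: eq_finset => s; rewrite (can2_eq (permKV s) (permK s)) [x == _]eq_sym.
rewrite perms_moving_split // card_imset; last exact: mulgI.
(* The union is disjoint: [y] is moved in the first set and fixed in the second. *)
rewrite cardsU; apply/eqP; rewrite -[X in _ == X]subn0; apply/eqP; congr (_ - _).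
apply/eqP; rewrite cards_eq0 -subset0; apply/subsetP=> t; rewrite !inE.
case/andP=> /andP[/eqP-> _] /andP[/eqP e _].
by move: yA; rewrite e !inE eqxx.
Qed.

(* Permutations of [t] points that move [m] prescribed ones, fix all others and
   have [c] cycles, the fixed points included. *)
Fixpoint derangements (t m c : nat) : nat :=
  match m with
  | 0 => c == t :> nat
  | 1 => 0
  | (m''.+1 as m').+1 => m' * (derangements t m' c.+1 + derangements t m'' c.+1)
  end.

Lemma derangementsE (t m c : nat) : derangements t m.+2 c =
  m.+1 * (derangements t m.+1 c.+1 + derangements t m c.+1).
Proof. by []. Qed.

Lemma card_perms_moving A (c : nat) : #|perms_moving A c| = derangements #|T| #|A| c.
Proof.
move: {2}_.+1 (ltnSn #|A|) => m; elim: m => // m IH in A c *; rewrite ltnS => Am.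
have [->|[x xA]] := set_0Vmem A; first by rewrite perms_moving0 cards0.
rewrite (card_perms_movingS _ xA).
have cA := cardsD1 x A; rewrite xA add1n in cA.
have [A0|A0] := posnP #|A :\ x|.
  rewrite cA A0 big_pred0 //= => y; apply/negbTE/negP=> yA.
  by rewrite (cardsD1 y) yA in A0.
rewrite cA -(prednK A0) derangementsE prednK // -sum_nat_const.
apply: eq_bigr => y yA; have cAy := cardsD1 y (A :\ x); rewrite yA add1n in cAy.
have -> : #|A :\ x|.-1 = #|A :\ x :\ y| by rewrite cAy.
by rewrite !IH //; move: Am; rewrite cA cAy; lia.
Qed.

End Derangements.

Lemma stirling1_assocE (n k : nat) : stirling1_assoc n k = derangements (n + k) (n + k) k.
Proof.
transitivity (derangements #|'I_(n + k)| #|[set: 'I_(n + k)]| k); last by rewrite cardsT card_ord.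
rewrite -card_perms_moving.
apply: eq_card => s; rewrite !inE andbC; congr (_ && _).
(* All cycles have size at least 2 exactly when no point is fixed. *)
apply/forallP/eqP => [sP|/setP sP X].
  apply/setP=> x; rewrite !inE; apply/negP=> /eqP sx.
  have /implyP/(_ (imset_f _ (erefl _))) := sP (porbit s x).
  by rewrite porbit_fixed // cards1.
apply/implyP=> /imsetP[x _ ->].
have := sP x; rewrite !inE => sx; apply/card_gt1P; exists (s x), x.
by rewrite (mem_porbit s 1 x) porbit_id sx.
Qed.

(** An additional fixed point is one additional cycle. The induction carries two consecutive values
    of [m] because the recurrence reaches back two steps. *)
Lemma derangementsSS (t m c : nat) : derangements t.+1 m c.+1 = derangements t m c.
Proof.
suff : derangements t.+1 m c.+1 = derangements t m c /\
       derangements t.+1 m.+1 c.+1 = derangements t m.+1 c by case.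
elim: m c => // m IH c; have [_ e1] := IH c; split=> //.
have [e2 e3] := IH c.+1.
by rewrite !derangementsE e2 e3.
Qed.

(** The [t - m] fixed points alone already give that many cycles. *)
Lemma derangements_small (t m c : nat) : c + m < t -> derangements t m c = 0.
Proof.
move=> H; suff : derangements t m c = 0 /\ (c + m.+1 < t -> derangements t m.+1 c = 0) by case.
elim: m c H => [|m IH] c H; first by split=> //=; rewrite ltn_eqF //; lia.
have [| _ e1] := IH c; first lia.
split=> [|H2]; first by apply: e1; lia.
have [|e2 e3] := IH c.+1; first lia.
by rewrite derangementsE e2 e3 ?muln0 //; lia.
Qed.

(** Beyond the [t - m] fixed points, [m] moved points form at most [m / 2] cycles. *)
Lemma derangements_large (t m c : nat) : t.*2 < c.*2 + m -> derangements t m c = 0.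
Proof.
suff : (forall c, t.*2 < c.*2 + m -> derangements t m c = 0) /\
       (forall c, t.*2 < c.*2 + m.+1 -> derangements t m.+1 c = 0).
  by case=> H _; apply: H.
elim: m {c} => [|m [IH1 IH2]]; split=> // c H.
  by rewrite /= gtn_eqF //; lia.
by rewrite derangementsE IH1 ?IH2 ?muln0 //; lia.
Qed.

(** Row [n.+1] counts derangements of [p.+2] points with [p = 2n - k]. Removing one point leaves a
    derangement of [p] points, counted at [k], or of [p.+1] points, counted at [k.-1]. *)
Lemma stirling1_revS n k :
  stirling1_rev n.+1 k = (n.*2.+1 - k) * (stirling1_rev n k + (0 < k) * stirling1_rev n k.-1).
Proof.
rewrite /stirling1_rev !stirling1_assocE.
have [kn|kn] := leqP k n.+1; last first.
  have -> : (k <= n) = false by lia.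
  have -> : (k.-1 <= n) = false by lia.
  by rewrite !muln0.
(* For [n > 0] the bound [k <= n.+1] gives [k <= n.*2], so that [p] below is not truncated. *)
have [n0|n0] := posnP n; first by rewrite n0 in kn *; case: k kn => [|[|]].
set p := n.*2 - k.
have -> : n.+1 + (n.+1 - k) = p.+2 by rewrite /p; lia.
have -> : n.*2.+1 - k = p.+1 by rewrite /p; lia.
rewrite derangementsE !derangementsSS addnC; congr (_ * (_ + _)).
  (* At [k = n.+1] a permutation with a fixed point would need to have no cycle. *)
  case: leqP => [kn'|nk]; last by rewrite derangements_small // /p; lia.
  have -> : n.+1 - k = (n - k).+1 by lia.
  have -> : n + (n - k) = p by rewrite /p; lia.
  exact: derangementsSS.
(* At [k = 0], [2n + 1] moved points cannot form [n + 1] cycles. *)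
case: posnP => [k0|k0]; first by rewrite derangements_large // /p k0; lia.
have -> : (k.-1 <= n) by lia.
rewrite mul1n; have -> : n + (n - k.-1) = p.+1 by rewrite /p; lia.
by have -> : n - k.-1 = n.+1 - k by lia.
Qed.

(** * Partitions into blocks of size at least 2 *)

Section BigPartitions.

Variable T : finType.
Implicit Types (A B : {set T}) (P : {set {set T}}).

Definition big_partitions A (k : nat) : {set {set {set T}}} :=
  [set P | [&& partition P A, #|P| == k & [forall X in P, 1 < #|X|]]].

Lemma card_big_partitions0 A : #|big_partitions A 0| = (A == set0).
Proof.
have -> : big_partitions A 0 = if A == set0 then [set set0] else set0; last first.
  by case: eqP; rewrite ?cards1 ?cards0.
apply/setP=> P; rewrite inE cards_eq0; case: (eqVneq A set0) => [->|A0]; rewrite !inE.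
  case: (eqVneq P set0) => [->|_]; last by rewrite andbF.
  by rewrite partition_set0 eqxx; apply/forallP=> X; rewrite inE.
case: (eqVneq P set0) => [->|_]; last by rewrite andbF.
by rewrite /partition /cover big_set0 eq_sym (negbTE A0).
Qed.

Lemma card_big_partitions_block A B k : B \subset A -> 1 < #|B| ->
  #|[set P in big_partitions A k.+1 | B \in P]| = #|big_partitions (A :\: B) k|.
Proof.
move=> BA B2; have B0 : B != set0 by rewrite -card_gt0 ltnW.
have notB P : P \in big_partitions (A :\: B) k -> B \notin P.
  rewrite inE => /andP[/andP[/eqP cP _] _]; apply/negP=> BP.
  have /set0Pn[x xB] := B0.
  have : x \in cover P by apply/bigcupP; exists B.
  by rewrite cP inE xB.
rewrite -[RHS](card_in_imset (f := fun P => B |: P)); last first.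
  by move=> P Q PA QA e; rewrite -(setU1K (notB _ PA)) e setU1K ?notB.
congr #|pred_of_set _|; apply/setP=> P; apply/idP/imsetP => [|[Q QP ->]].
  rewrite !inE => /andP[/and3P[pP /eqP cP /forallP bP] BP].
  exists (P :\ B); last by rewrite setD1K.
  rewrite inE partitionD1 //=; have := cardsD1 B P; rewrite BP cP add1n => -[<-].
  by rewrite eqxx; apply/forallP=> X; apply/implyP=> /setD1P[_]; apply/implyP.
have nQ := notB _ QP; move: QP; rewrite !inE eqxx /= andbT cardsU1 nQ add1n eqSS.
case/and3P=> pQ -> /forallP bQ.
have -> : A = B :|: (A :\: B) by rewrite -[LHS](setID _ B) (setIidPr BA).
rewrite partitionU1 //=; last by rewrite disjoints_subset; apply/subsetP=> x; rewrite !inE => ->.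
by apply/forallP=> X; apply/implyP=> /setU1P[->|] //; apply/implyP.
Qed.

(* Both sides count the pairs of a partition and one of its blocks. *)
Lemma card_big_partitions_blocks A k :
  \sum_(B : {set T} | (B \subset A) && (1 < #|B|)) #|big_partitions (A :\: B) k| =
  k.+1 * #|big_partitions A k.+1|.
Proof.
transitivity (\sum_(P in big_partitions A k.+1) \sum_(B in P) 1); last first.
  rewrite mulnC -sum_nat_const; apply: eq_bigr => P; rewrite inE => /and3P[_ /eqP<- _].
  by rewrite sum1_card.
rewrite (exchange_big_dep (fun B : {set T} => (B \subset A) && (1 < #|B|))) /=.
  by apply: eq_bigr => B /andP[BA B2]; rewrite sum1dep_card card_big_partitions_block.
move=> P B; rewrite inE => /and3P[pP _ /forallP/(_ B)/implyP bP] BP.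
by rewrite bP // andbT -(cover_partition pP); apply: (bigcup_max B).
Qed.

(** If the block of [x] has at least three elements, deleting [x] leaves a partition with one of its
    [k.+1] blocks marked; otherwise the block is a pair [{x, y}], which is removed whole. *)
Lemma card_big_partitionsS A x k : x \in A ->
  #|big_partitions A k.+1| =
  k.+1 * #|big_partitions (A :\ x) k.+1| + \sum_(y in A :\ x) #|big_partitions (A :\ x :\ y) k|.
Proof.
move=> xA.
pose Q B := [&& B \subset A, 1 < #|B| & x \in B].
rewrite -sum1_card (partition_big (fun P => pblock P x) Q) /=; last first.
  move=> P; rewrite inE => /and3P[pP _ /forallP bP].
  have xc : x \in cover P by rewrite (cover_partition pP).
  have bx := pblock_mem xc.
  rewrite /Q mem_pblock xc andbT (implyP (bP _) bx) andbT -(cover_partition pP).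
  exact: (bigcup_max _ bx).
transitivity (\sum_(B | Q B) #|big_partitions (A :\: B) k|).
  apply: eq_bigr => B /and3P[BA B2 xB]; rewrite sum1dep_card -card_big_partitions_block //.
  apply: eq_card => P; rewrite !inE; case: (boolP (partition P A)) => //= pP; congr (_ && _).
  have [cP tP _] := and3P pP; have xc : x \in cover P by rewrite (eqP cP).
  by apply/eqP/idP => [<-|BP]; [apply: pblock_mem | apply: def_pblock].
rewrite (reindex_onto (fun B => x |: B) (fun B => B :\ x)) /=; last first.
  by move=> B /and3P[_ _ xB]; rewrite setD1K.
have QE B : Q (x |: B) && ((x |: B) :\ x == B) = (B \subset A :\ x) && (0 < #|B|).
  rewrite /Q setU11 andbT subUset sub1set xA /= subsetD1.
  have [xB|xB] := boolP (x \in B).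
    rewrite !andbF /=; apply/negbTE; rewrite negb_and; apply/orP; right.
    by apply/eqP=> e; rewrite -e !inE eqxx in xB.
  by rewrite cardsU1 xB add1n ltnS setU1K // eqxx !andbT.
(* Here [B] is the block of [x] without [x]. The case [1 < #|B|] is evaluated by the double count of
   partitions and blocks; the other case has [B] a singleton. *)
rewrite (eq_bigl _ _ QE) (bigID (fun B : {set T} => 1 < #|B|)) /=; congr (_ + _).
  rewrite -card_big_partitions_blocks; apply: eq_big => [B|B _].
    by case: (_ \subset _) => //=; case: #|B| => [|[]].
  by rewrite setDDl.
transitivity (\sum_(B in [set [set y] | y in A :\ x]) #|big_partitions (A :\: (x |: B)) k|).
  apply: eq_bigl => B; apply/andP/imsetP => [[/andP[BA B0] B1]|[y yA ->]].
    have /cards1P[y yB] : #|B| == 1 by lia.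
    by exists y; rewrite // -sub1set -yB.
  by rewrite sub1set yA cards1.
rewrite big_imset /=; last by move=> y z _ _ /set1_inj.
by apply: eq_bigr => y _; rewrite setDDl.
Qed.

(** The associated Stirling numbers of the second kind, with [m] the total number of elements. *)
Fixpoint assoc_stirling2 (m k : nat) : nat :=
  match m, k with
  | 0, _ => k == 0 :> nat
  | 1, _ => 0
  | _, 0 => 0
  | (m''.+1 as m').+1, k'.+1 => k * assoc_stirling2 m' k + m' * assoc_stirling2 m'' k'
  end.

Lemma assoc_stirling2E (m k : nat) : assoc_stirling2 m.+2 k.+1 =
  k.+1 * assoc_stirling2 m.+1 k.+1 + m.+1 * assoc_stirling2 m k.
Proof. by []. Qed.

Lemma card_big_partitions A (k : nat) : #|big_partitions A k| = assoc_stirling2 #|A| k.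
Proof.
move: {2}_.+1 (ltnSn #|A|) => m; elim: m => // m IH in A k *; rewrite ltnS => Am.
case: k => [|k].
  by rewrite card_big_partitions0 -cards_eq0; case: #|A| => [|[]].
have [->|[x xA]] := set_0Vmem A.
  rewrite cards0; apply/eqP; rewrite cards_eq0; apply/eqP/setP=> P; rewrite !inE.
  by rewrite partition_set0; case: eqP => //= ->; rewrite cards0.
rewrite (card_big_partitionsS _ xA).
have cA := cardsD1 x A; rewrite xA add1n in cA.
have [A0|A0] := posnP #|A :\ x|.
  rewrite big_pred0 => [|y]; last by apply/negbTE/negP=> yA; rewrite (cardsD1 y) yA in A0.
  rewrite addn0 IH ?cA ?A0; [exact: muln0 | by rewrite -A0 -cA].
rewrite cA -(prednK A0) assoc_stirling2E prednK // IH ?cA -?cA //; congr (_ + _).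
rewrite -sum_nat_const.
apply: eq_bigr => y yA; have cAy := cardsD1 y (A :\ x); rewrite yA add1n in cAy.
have -> : #|A :\ x|.-1 = #|A :\ x :\ y| by rewrite cAy.
by rewrite IH //; move: Am; rewrite cA cAy; lia.
Qed.

End BigPartitions.

Lemma stirling2_assocE (n k : nat) : stirling2_assoc n k = assoc_stirling2 (n + k) k.
Proof.
by rewrite -[X in assoc_stirling2 X]card_ord -cardsT -card_big_partitions.
Qed.

Lemma assoc_stirling2_large (m k : nat) : m < k.*2 -> assoc_stirling2 m k = 0.
Proof.
suff : (forall k, m < k.*2 -> assoc_stirling2 m k = 0) /\
       (forall k, m.+1 < k.*2 -> assoc_stirling2 m.+1 k = 0).
  by case=> H _; apply: H.
elim: m {k} => [|m [IH1 IH2]]; split=> // k H.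
  by rewrite /= gtn_eqF //; lia.
case: k H => // k H; rewrite assoc_stirling2E IH1 ?IH2 ?muln0 //; lia.
Qed.

Lemma stirling2_revS n k :
  stirling2_rev n.+1 k =
  (n.*2.+1 - k) * stirling2_rev n k + (0 < k) * ((n.+1 - k) * stirling2_rev n k.-1).
Proof.
rewrite /stirling2_rev !stirling2_assocE.
have [kn|kn] := leqP k n.+1; last first.
  have -> : (k <= n) = false by lia.
  have -> : (k.-1 <= n) = false by lia.
  by rewrite !muln0.
have [n0|n0] := posnP n; first by rewrite n0 in kn *; case: k kn => [|[|]].
have [kn'|nk] := leqP k n; last first.
  have -> : k = n.+1 by lia.
  by rewrite subnn addn0 !mul0n !muln0 -(prednK n0).
set p := n.*2 - k.
have -> : n.+1 + (n.+1 - k) = p.+2 by rewrite /p; lia.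
have -> : n.*2.+1 - k = p.+1 by rewrite /p; lia.
have -> : n + (n - k) = p by rewrite /p; lia.
have -> : n.+1 - k = (n - k).+1 by lia.
rewrite assoc_stirling2E addnC; congr (_ + _).
(* At [k = 0], [2n + 1] elements cannot fill [n + 1] blocks of size at least 2. *)
case: posnP => [k0|k0]; first by rewrite assoc_stirling2_large ?muln0 // /p k0; lia.
have -> : (k.-1 <= n) by lia.
have -> : n - k.-1 = (n - k).+1 by lia.
by rewrite mul1n; congr (_ * assoc_stirling2 _ _); rewrite /p; lia.
Qed.

(** * Binomial identities *)

(* A Stirling permutation of size [n > 0] has at most [n - 1] ascents. *)
Lemma eq_sum_stirling_words n (g h : nat -> nat) :
  (forall a, a <= n.-1 -> g a = h a) ->
  sum_stirling_words n g = sum_stirling_words n h.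
Proof.
elim: n g h => [|n IH] g h gh; first by rewrite !sum_stirling_words0 gh.
rewrite !sum_stirling_wordsS; apply: IH => a an.
rewrite gh; last by apply: leq_trans an (leq_pred n).
(* From the empty word the value at [a.+1] is out of range, but its weight [0.*2 - a] is zero. *)
case: n an gh => [|n] an gh; first by rewrite !mul0n.
by rewrite (gh a.+1).
Qed.

Lemma sum_stirling_words_linear n c d (g h : nat -> nat) :
  sum_stirling_words n (fun a => c * g a + d * h a) =
  c * sum_stirling_words n g + d * sum_stirling_words n h.
Proof. by rewrite /sum_stirling_words big_split !big_distrr. Qed.

Lemma stirling1_rev_sum n k :
  stirling1_rev n k = sum_stirling_words n (fun a => 'C(a, k)).
Proof.
elim: n k => [|n IH] k.
  rewrite sum_stirling_words0 /stirling1_rev bin0n; case: k => //.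
  by rewrite stirling1_assocE.
rewrite stirling1_revS sum_stirling_wordsS !IH mulnDr mulnA -sum_stirling_words_linear.
(* Since [(a+1) C(a,k) = (a+1-k) C(a+1,k)], the insertion side is [(2n+1-k) C(a+1,k)], and Pascal's
   rule gives the other side. *)
apply: eq_sum_stirling_words => a an; rewrite mul_bin_down -mulnDl.
case: k => [|k]; first by rewrite muln0 mul0n addn0 !bin0 !muln1; lia.
rewrite muln1 /= -mulnDr -binS.
have [ka|ak] := leqP k a; last by rewrite bin_small ?muln0.
by congr (_ * _); lia.
Qed.

Lemma stirling2_rev_sum n k :
  stirling2_rev n.+1 k = sum_stirling_words n.+1 (fun a => 'C(n - a, k)).
Proof.
elim: n k => [|n IH] k.
  rewrite sum_stirling_wordsS sum_stirling_words0 /stirling2_rev bin0n mul0n addn0 mul1n.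
  by case: k => [|[|k]]; rewrite ?stirling2_assocE.
rewrite stirling2_revS sum_stirling_wordsS !IH mulnA -sum_stirling_words_linear.
apply: eq_sum_stirling_words => a /= an; rewrite subSS (subSn an).
(* Writing [n = a + m], and later [m = k + r], removes all truncated subtractions. *)
have [m nE] : exists m, n = a + m by exists (n - a); rewrite subnKC.
rewrite nE addKn; case: k => [|k]; first by rewrite mul0n !bin0; lia.
rewrite binS /= mul1n; have := mul_bin_left m k.
have [km|mk] := leqP k m; last by rewrite !bin_small ?muln0 ?(ltnW mk) // ltnW.
have [r ->] : exists r, m = k + r by exists (m - k); rewrite subnKC.
rewrite addKn; set A := 'C(_, k.+1); set B := 'C(_, k) => AB.
have -> : (a + (k + r)).+1.*2.+1 - k.+1 = a.*2 + k + r.*2 + 2 by lia.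
have -> : (a + (k + r)).+2 - k.+1 = a + r + 1 by lia.
have -> : (a + (k + r)).+1.*2 - a = a + k.*2 + r.*2 + 2 by lia.
(* After cancellation only [AB] remains, that is [(k+1) A = r B]. *)
nia.
Qed.

Theorem proposition1p2 :
  stirling1_rev =2 ltmul eulerian2_mx binmx /\
  stirling2_rev =2 ltmul eulerian2_rev binmx.
Proof.
split=> n k; rewrite /ltmul; first by rewrite stirling1_rev_sum -sum_eulerian2.
case: n => [|n].
  rewrite big_ord1 /binmx bin0n mul1n /stirling2_rev.
  by case: k => //; rewrite stirling2_assocE.
(* The guard makes the term at [a = n.+1] vanish, where truncated subtraction would give
   ['C(0, k)]. *)
pose g a := if a <= n then 'C(n - a, k) else 0.
have -> : stirling2_rev n.+1 k = sum_stirling_words n.+1 g.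
  by rewrite stirling2_rev_sum; apply: eq_sum_stirling_words => a an; rewrite /g an.
(* Both sums lose their top term, and the substitution of [n - j] for [j] matches the row
   reversal. *)
rewrite -sum_eulerian2 big_ord_recr [RHS]big_ord_recr /= /g ltnn muln0.
rewrite /eulerian2_rev /= ltnn mul0n !addn0 (reindex_inj rev_ord_inj) /=.
apply: eq_bigr => i _; have := ltn_ord i => lin.
rewrite subSS leq_subr lin subKn // /binmx.
by congr (eulerian2 _ _ * _); lia.
Qed.
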